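(* Let $r\ge1$, $\mathbf{a},\mathbf{b}\in\mathbb{C}^r$ with $a_i-a_j\notin\mathbb{Z}$ for $i\ne j$, $\mathbf{m},\mathbf{n}\in\mathbb{Z}^r$, and assume all expressions below are well defined (e.g. $b_j-a_i\notin\mathbb{Z}$ for all $i,j$). Put $M=\sum_i m_i$, $N=\sum_i n_i$, $m_{\min}=\min_i m_i$, $p=\max\{-1,M-N-r+1\}$. Then for all integers $k\ge-m_{\min}$ $$\sum_{i=1}^{r}\frac{(1-\mathbf{b}+a_i)_{\mathbf{m}+k}}{(a_i-\mathbf{a}_{[i]})_{\mathbf{n}_{[i]}+k+1}\,(k+n_i)!}\;{}_{2r}F_{2r-1}\!\left(\begin{matrix}-k-n_i,\;\mathbf{b}-a_i,\;1+\mathbf{a}_{[i]}-a_{i}-\mathbf{n}_{[i]}-k-1\\\mathbf{b}-a_{i}-\mathbf{m}-k,\;1+\mathbf{a}_{[i]}-a_{i}\end{matrix}\right)=q_p(k),$$ where terms with $k+n_i<0$ are taken to be zero, and $q_p(k)$ is defined by $q_{-1}(k)=0$, $q_0(k)=1$ and, for $p\ge1$, $$q_p(k)=\frac{1}{p}\sum_{j=1}^{p}\frac{(-1)^{j+1}}{j+1}Q_{j}(k)\,q_{p-j}(k),$$ $$Q_{j}(k)=\sum_{i=1}^{r}\big[\mathcal{B}_{j+1}(-a_i-k)-\mathcal{B}_{j+1}(-b_i+1-k)+\mathcal{B}_{j+1}(1-b_i+m_i)-\mathcal{B}_{j+1}(1-a_i+n_i)\big].$$ In particular, $q_1(k)=\dfrac{Q_1(k)}{2}$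 and $q_2(k)=\dfrac{Q_1^2(k)}{8}-\dfrac{Q_2(k)}{6}$.
   Context: $\mathcal{B}_j(x)$ are the classical Bernoulli polynomials, $\frac{t e^{xt}}{e^t-1}=\sum_{j\ge0}\mathcal{B}_j(x)\frac{t^j}{j!}$. For $k\in\mathbb{Z}$, $(c)_k=\Gamma(c+k)/\Gamma(c)$. For vectors of equal length $(\mathbf{u})_{\mathbf{k}}=\prod_j(u_j)_{k_j}$; sums of a vector and a scalar are componentwise; $\mathbf{u}_{[i]}$ is $\mathbf{u}$ with the $i$-th component removed. Thus $(1-\mathbf{b}+a_i)_{\mathbf{m}+k}=\prod_{l=1}^r(1-b_l+a_i)_{m_l+k}$ and $(a_i-\mathbf{a}_{[i]})_{\mathbf{n}_{[i]}+k+1}=\prod_{l\ne i}(a_i-a_l)_{n_l+k+1}$. Vectors in hypergeometric parameter lists denote the lists of their components; ${}_{2r}F_{2r-1}$ is the (here terminating) generalized hypergeometric series $\sum_{s\ge0}\frac{(\mathbf{u})_s}{(\mathbf{v})_s\,s!}$ at unit argument. *)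

(* Defs.v *)
From HB Require Import structures.
From mathcomp Require Import all_boot all_order all_algebra.
From mathcomp Require Import complex.
From mathcomp Require Import all_classical all_reals all_analysis.

Set Implicit Arguments.
Unset Strict Implicit.
Unset Printing Implicit Defensive.

Import Order.TTheory GRing.Theory Num.Theory.
Import numFieldNormedType.Exports.
Local Open Scope ring_scope.

(* (c)_k = Gamma(c + k) / Gamma(c) for k in Z, written as the finite product
   given by Gamma(z + 1) = z Gamma(z); see pochE below. *)
Definition poch (F : fieldType) (c : F) (k : int) : F :=
  match k with
  | Posz n => \prod_(j < n) (c + j%:R)
  | Negz n => (\prod_(j < n.+1) (c - j.+1%:R))^-1
  end.

Lemma poch_pS (F : fieldType) (c : F) (n : nat) :
  poch c n.+1%:Z = poch c n%:Z * (c + n%:R).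
Proof. by rewrite /poch big_ord_recr. Qed.

(* Outside the integers, poch is the Gamma quotient for any solution G of the
   functional equation of Gamma. *)
Lemma pochE (F : fieldType) (G : F -> F) (c : F) (k : int) :
  (forall z : int, c != z%:~R) ->
  (forall x : F, (forall z : int, x != z%:~R) -> G (x + 1) = x * G x) ->
  G (c + k%:~R) = poch c k * G c.
Proof.
move=> cZ GS.
have nZ (u : int) : forall z : int, c + u%:~R != z%:~R.
  move=> z; apply/negP => /eqP h; have /negP := cZ (z - u); apply.
  by apply/eqP; rewrite rmorphB /= -h addrK.
case: k => n.
  elim: n => [|n IH]; first by rewrite /poch big_ord0 mul1r addr0.
  rewrite poch_pS mulrAC -IH [RHS]mulrC -[c + n%:R]/(c + n%:~R) -GS //.
  by rewrite -addrA; congr (G (c + _)); rewrite -[RHS]/(n%:R + 1) natr1.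
rewrite NegzE /=.
elim: n => [|n IH].
  rewrite big_ord1 -[in RHS](subrK 1 c) GS; last exact: (nZ (-1)).
  have h : c - 1 != 0 by have := nZ (-1) 0.
  by rewrite subrK mulrA mulVf // mul1r.
rewrite big_ord_recr /= invfM mulrAC -IH.
have h : c - n.+2%:R != 0.
  by have := nZ (- n.+2%:Z) 0; rewrite rmorphN.
apply: (mulIf h); rewrite mulfVK // mulrC.
rewrite [(- n.+2%:Z)%:~R]rmorphN /= -GS; last first.
  by have := nZ (- n.+2%:Z); rewrite rmorphN.
congr G; rewrite rmorphN /= -addrA; congr (_ + _).
by rewrite -pmulrn -[n.+2%:R]natr1 opprD subrK.
Qed.

(* Formal power series sum_n f_n t^n, as coefficient sequences. *)
Definition fps_mul (F : fieldType) (f g : nat -> F) (n : nat) : F :=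
  \sum_(i < n.+1) f i * g (n - i)%N.

(* The coefficients g_n, ..., g_0 of 1 / f, in this order: g_0 = 1 / f_0 and
   g_n = - (f_1 g_(n-1) + ... + f_n g_0) / f_0. *)
Fixpoint fps_inv_seq (F : fieldType) (f : nat -> F) (n : nat) : seq F :=
  if n is n'.+1 then
    let s := fps_inv_seq f n' in
    (- (f 0%N)^-1 * \sum_(j < n) f j.+1 * s`_j) :: s
  else [:: (f 0%N)^-1].

Definition fps_inv (F : fieldType) (f : nat -> F) (n : nat) : F :=
  (fps_inv_seq f n)`_0.

Lemma nth_fps_inv_seq (F : fieldType) (f : nat -> F) (n j : nat) :
  (j <= n)%N -> (fps_inv_seq f n)`_j = fps_inv f (n - j).
Proof.
elim: n j => [|n IH] [|j] //= jn.
by rewrite IH // subSS.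
Qed.

Lemma fps_mulV (F : fieldType) (f : nat -> F) : f 0%N != 0 ->
  fps_mul f (fps_inv f) =1 (fun n => (n == 0%N)%:R).
Proof.
move=> f0 [|n]; rewrite /fps_mul big_ord_recl /=.
  by rewrite big_ord0 addr0 /fps_inv /= divff.
rewrite {1}/fps_inv /= mulrA mulrN divff // mulN1r.
apply/eqP; rewrite addrC subr_eq0; apply/eqP/eq_bigr => i _.
by rewrite /bump /= add1n subSS nth_fps_inv_seq // -ltnS.
Qed.

(* e^(xt), and (e^t - 1) / t *)
Definition fps_exp (F : fieldType) (x : F) (n : nat) : F := x ^+ n / (n`!)%:R.
Definition fps_expm1_div (F : fieldType) (n : nat) : F := fps_exp 1 n.+1.

(* B_j(x), from t e^(xt) / (e^t - 1) = sum_j B_j(x) t^j / j! *)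
Definition bernoulli_poly (F : fieldType) (j : nat) (x : F) : F :=
  (j`!)%:R * fps_mul (fps_exp x) (fps_inv (fps_expm1_div F)) j.

(* The generalized hypergeometric series at unit argument, with lists of upper
   parameters u and lower parameters v; R[i]^o is R[i] with its topology. *)
Definition hypergeom1 (R : realType) (u v : seq R[i]) : R[i] :=
  limn (fun n : nat => (\sum_(0 <= s < n)
    (\prod_(x <- u) poch x s%:Z) /
      ((\prod_(y <- v) poch y s%:Z) * (s`!)%:R) : R[i]^o)).

Section Summation.
Variables (R : realType) (r : nat).
Implicit Types (a b : 'I_r -> R[i]) (m n : 'I_r -> int) (i l : 'I_r) (k : int).

Definition vmin (r_gt0 : (0 < r)%N) m : int :=
  \big[Num.min/m (Ordinal r_gt0)]_(i < r) m i.

Definition upper_params a b n k i : seq R[i] :=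
  - (k + n i)%:~R ::
    [seq b l - a i | l <- enum 'I_r] ++
    [seq 1 + a l - a i - (n l)%:~R - k%:~R - 1 | l <- enum 'I_r & l != i].

Definition lower_params a b m k i : seq R[i] :=
  [seq b l - a i - (m l)%:~R - k%:~R | l <- enum 'I_r] ++
  [seq 1 + a l - a i | l <- enum 'I_r & l != i].

Definition prefactor a b m n k i : R[i] :=
  (\prod_(l < r) poch (1 - b l + a i) (m l + k)) /
  ((\prod_(l < r | l != i) poch (a i - a l) (n l + k + 1))
     * ((absz (k + n i))`!)%:R).

Definition Qsum a b m n (j : nat) k : R[i] :=
  \sum_(i < r)
    (bernoulli_poly j.+1 (- a i - k%:~R)
     - bernoulli_poly j.+1 (- b i + 1 - k%:~R)
     + bernoulli_poly j.+1 (1 - b i + (m i)%:~R)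
     - bernoulli_poly j.+1 (1 - a i + (n i)%:~R)).

(* The values q_p(k), ..., q_0(k), in this order; see qvalS. *)
Fixpoint qseq a b m n (p : nat) k : seq R[i] :=
  if p is p'.+1 then
    let s := qseq a b m n p' k in
    (p%:R^-1 * \sum_(1 <= j < p.+1)
       (-1) ^+ j.+1 / j.+1%:R * Qsum a b m n j k * s`_j.-1) :: s
  else [:: 1].

Definition qval a b m n (p : int) k : R[i] :=
  if p is Posz p' then (qseq a b m n p' k)`_0 else 0.

Lemma nth_qseq a b m n (p j : nat) k :
  (j <= p)%N -> (qseq a b m n p k)`_j = qval a b m n (p - j)%N%:Z k.
Proof.
elim: p j => [|p IH] [|j] //= jp.
by rewrite IH // subSS.
Qed.

Lemma qvalN1 a b m n k : qval a b m n (-1) k = 0.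
Proof. by []. Qed.

Lemma qval0 a b m n k : qval a b m n 0 k = 1.
Proof. by []. Qed.

Lemma qvalS a b m n (p : nat) k : (0 < p)%N ->
  qval a b m n p%:Z k =
  p%:R^-1 * \sum_(1 <= j < p.+1)
    (-1) ^+ j.+1 / j.+1%:R * Qsum a b m n j k * qval a b m n (p - j)%N%:Z k.
Proof.
case: p => // p _; rewrite [LHS]/=; congr (_ * _).
apply: eq_big_nat => -[|j] //= jp.
by rewrite nth_qseq // subSS.
Qed.

End Summation.

(* Main.v *)
(* With y = x + k, the s-th term of the i-th series is the residue at
   y = a_i + k - s of
     f(y) = prod_l (1 - b_l - k + y)_(m_l + k) / prod_l (y - a_l - k)_(n_l + k + 1),
   so the left-hand side is the coefficient of 1 / y in the expansion of f at
   infinity.  If f has zeros A and simple poles B, this is the coefficient of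
   t^(|A| + 1 - |B|) in g(t) = prod_(c in A) (1 - c t) / prod_(x in B) (1 - x t).
   From t g'(t) / g(t) = sum_(j >= 1) s_j t^j with
   s_j = sum_(x in B) x^j - sum_(c in A) c^j, the coefficients of g satisfy
   p g_p = sum_(j = 1 .. p) s_j g_(p - j); A and B consist of arithmetic
   progressions, whose power sums are differences of Bernoulli polynomials. *)

Require Import Defs.
From mathcomp Require Import all_boot all_order all_algebra.
From mathcomp Require Import complex.
From mathcomp Require Import all_classical all_reals all_analysis.
From mathcomp Require Import ring zify.

Set Implicit Arguments.
Unset Strict Implicit.

Import Order.TTheory GRing.Theory Num.Theory.
Import numFieldNormedType.Exports.
Local Open Scope ring_scope.

(** * Residues and series expansions *)

Section FactorSeries.
Variable F : numFieldType.
Implicit Types (g s : nat -> F) (c x y : F) (A B : seq F).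

(** Multiplication by 1 - c t; [fps_div_factor] solves h = g + c t h, so [factor_series] expands
    prod_(c in A) (1 - c t) / prod_(x in B) (1 - x t). *)
Definition fps_mul_factor c g : nat -> F :=
  fun n => g n - c * (if n is n'.+1 then g n' else 0).

Fixpoint fps_div_factor c g (n : nat) : F :=
  g n + c * (if n is n'.+1 then fps_div_factor c g n' else 0).

Definition factor_series A B : nat -> F :=
  foldr fps_mul_factor
    (foldr fps_div_factor (fun n => (n == 0%N)%:R) B) A.

Lemma fps_mul_factorC c y g :
  fps_mul_factor c (fps_mul_factor y g) =1 fps_mul_factor y (fps_mul_factor c g).
Proof. by case=> [|[|n]]; rewrite /fps_mul_factor; ring. Qed.

Lemma eq_fps_mul_factor c g g' :
  g =1 g' -> fps_mul_factor c g =1 fps_mul_factor c g'.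
Proof. by move=> gg' [|n]; rewrite /fps_mul_factor !gg'. Qed.

Lemma fps_div_factorK c g : fps_mul_factor c (fps_div_factor c g) =1 g.
Proof. by case=> [|n]; rewrite /fps_mul_factor /=; ring. Qed.

Lemma factor_series_cancel A B c :
  fps_mul_factor c (factor_series A (c :: B)) =1 factor_series A B.
Proof.
elim: A => [|y A IH] n /=; first exact: fps_div_factorK.
by rewrite fps_mul_factorC; apply: eq_fps_mul_factor.
Qed.

Lemma factor_series0 A B : factor_series A B 0 = 1.
Proof.
elim: A => [|y A IH] /=; last by rewrite /fps_mul_factor IH mulr0 subr0.
by elim: B => [//|x B /= IH]; rewrite mulr0 addr0.
Qed.

Lemma factor_series_degree A n : (size A < n)%N -> factor_series A [::] n = 0.
Proof.
elim: A n => [|y A IH] [|n] //= An.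
by rewrite /fps_mul_factor !IH ?mulr0 ?subr0 //; apply: ltnW.
Qed.

(* The n-th coefficient of t g'(t) - S(t) g(t), where S(t) = sum_(j >= 1) s_j t^j. *)
Definition logder_defect s g (n : nat) : F :=
  n%:R * g n - \sum_(i < n) s (n - i)%N * g i.

(** Since t (1 - c t)' / (1 - c t) = - sum_(j >= 1) c^j t^j, the new factor shifts the logarithmic
    derivative by these powers. *)
Lemma logder_defect_mul_factor s g c :
  logder_defect (fun j => s j - c ^+ j) (fps_mul_factor c g) =1
  fps_mul_factor c (logder_defect s g).
Proof.
(* Coefficientwise form of (c t / (1 - c t)) (1 - c t) g = c t g. *)
have tel n : \sum_(i < n.+1) c ^+ (n.+1 - i) * fps_mul_factor c g i = c * g n.
  elim: n => [|n IH].
    by rewrite big_ord_recl big_ord0 /fps_mul_factor /=; ring.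
  rewrite big_ord_recr /= subSnn.
  under eq_bigr => i _ do rewrite subSn ?(ltnW (ltn_ord i)) // exprS -mulrA.
  by rewrite -mulr_sumr IH /fps_mul_factor; ring.
case=> [|n]; rewrite /logder_defect.
  by rewrite /fps_mul_factor !big_ord0 !mul0r; ring.
under eq_bigr => i _ do rewrite mulrBl.
rewrite sumrB tel.
have -> : \sum_(i < n.+1) s (n.+1 - i)%N * fps_mul_factor c g i =
    \sum_(i < n.+1) s (n.+1 - i)%N * g i - c * \sum_(i < n) s (n - i)%N * g i.
  rewrite big_ord_recl [in RHS]big_ord_recl /= mulr_sumr -addrA -sumrB.
  congr (_ + _); first by rewrite /fps_mul_factor mulr0 subr0.
  by apply: eq_bigr => i _; rewrite /fps_mul_factor /bump /= add1n subSS; ring.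
by rewrite -natr1 /fps_mul_factor; ring.
Qed.

Lemma eq_logder_defect s s' g n :
  s =1 s' -> logder_defect s g n = logder_defect s' g n.
Proof.
by move=> ss'; congr (_ - _); apply: eq_bigr => i _; rewrite ss'.
Qed.

Lemma logder_factor_series A B n :
  logder_defect (fun j => \sum_(x <- B) x ^+ j - \sum_(x <- A) x ^+ j)
    (factor_series A B) n = 0.
Proof.
elim: A n => [|y A IH] n /=; last first.
  rewrite (@eq_logder_defect _
    (fun j => (\sum_(x <- B) x ^+ j - \sum_(x <- A) x ^+ j) - y ^+ j)).
    by rewrite logder_defect_mul_factor; case: n => [|n];
      rewrite /fps_mul_factor !IH mulr0 subr0.
  by move=> j; rewrite big_cons; ring.
elim: B n => [|x B IH] n /=.
  rewrite /logder_defect big1 => [|i _].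
    by case: n => *; rewrite /= ?mulr0 ?mul0r subr0.
  by rewrite !big_nil subr0 mul0r.
set s := (fun j : nat => _); set h := (h in logder_defect _ h).
(* 1 - x t times the defect of [h] is the defect of the series without the pole x, zero by
   induction; the factor 1 - x t is then cancelled. *)
have step k : fps_mul_factor x (logder_defect s h) k = 0.
  rewrite -logder_defect_mul_factor -[RHS](IH k) /logder_defect.
  rewrite fps_div_factorK; congr (_ - _); apply: eq_bigr => i _.
  by rewrite fps_div_factorK /s big_cons !big_nil; congr (_ * _); ring.
elim: n => [|n IHn]; first by rewrite /logder_defect big_ord0 mul0r subr0.
by have := step n.+1; rewrite /fps_mul_factor IHn mulr0 subr0.
Qed.

(** The equation n g_n = sum_(i < n) s_(n-i) g_i fixes g_n for n > 0, as n is invertible in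
    characteristic 0. *)
Lemma logder_unique s g g' : g 0 = g' 0 ->
  logder_defect s g =1 (fun=> 0) -> logder_defect s g' =1 (fun=> 0) -> g =1 g'.
Proof.
move=> g0 Hg Hg' n; elim/ltn_ind: n => -[//|n] IH.
have n0 : n.+1%:R != 0 :> F by rewrite pnatr_eq0.
apply: (mulfI n0); move/eqP: (Hg n.+1); rewrite subr_eq0 => /eqP ->.
move/eqP: (Hg' n.+1); rewrite subr_eq0 => /eqP ->.
by apply: eq_bigr => i _; rewrite IH.
Qed.

(* The sum of the residues of prod_(y <- A) (z - y) / prod_(x <- B) (z - x). *)
Definition residue_sum A B : F :=
  \sum_(x <- B) (\prod_(y <- A) (x - y)) / \prod_(y <- B | y != x) (x - y).

Lemma residue_sum_perm A B B' :
  perm_eq B B' -> residue_sum A B = residue_sum A B'.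
Proof.
move=> BB'; rewrite /residue_sum (perm_big _ BB') /=.
by apply: eq_bigr => x _; rewrite (perm_big _ BB').
Qed.

Lemma residue_sum_head A B x : uniq (x :: B) ->
  residue_sum (x :: A) (x :: B) = residue_sum A B.
Proof.
move=> /= /andP[xB uB]; rewrite /residue_sum !big_cons subrr !mul0r add0r.
apply: eq_big_seq => y yB; have yx : y != x by apply: contraNneq xB => <-.
rewrite !big_cons eq_sym yx invfM mulrACA divff ?mul1r //.
by rewrite subr_eq0.
Qed.

(* (z - c) = (z - x) + (x - c) *)
Lemma residue_sum_step A B c x : uniq (x :: B) ->
  residue_sum (c :: A) (x :: B) =
  residue_sum A B + (x - c) * residue_sum A (x :: B).
Proof.
move=> uB; rewrite -[in RHS](residue_sum_head A uB) /residue_sum.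
rewrite mulr_sumr -big_split /=.
by apply: eq_bigr => y _; rewrite !big_cons !mulrA -!mulrDl; congr (_ * _ * _); ring.
Qed.

Lemma residue_sum_nil B : uniq B -> residue_sum [::] B = (size B == 1%N)%:R.
Proof.
move: {2}(size B) (leqnn (size B)) => n; elim: n B => [|n IH] B.
  by case: B => //= *; rewrite /residue_sum big_nil.
case: B => [|x [|y B]] /=.
- by rewrite /residue_sum big_nil.
- by move=> _ _; rewrite /residue_sum !big_cons !big_nil eqxx invr1 mulr1 addr0.
rewrite ltnS => Bn uB; have /andP[/norP[xy xB] /andP[yB uB']] := uB.
have uxB : uniq (x :: B) by rewrite /= xB.
(* With c = y the left side loses the pole y; both remaining sums have one pole fewer and agree by
   induction, so (x - y) times the wanted sum is 0. *)
have e1 := residue_sum_step [::] y uB.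
have py : perm_eq (x :: y :: B) (y :: x :: B).
  by have /permPl := perm_catCA [:: x] [:: y] B; apply.
rewrite (residue_sum_perm _ py) residue_sum_head in e1; last by rewrite -(perm_uniq py).
rewrite (IH (x :: B)) ?(IH (y :: B)) //= ?yB // in e1.
have /eqP : (x - y) * residue_sum [::] [:: x, y & B] = 0.
  by rewrite -[LHS](addKr (size B == 0)%:R) -e1 addNr.
by rewrite mulf_eq0 subr_eq0 (negPf xy) => /eqP.
Qed.

(** The series mirror [residue_sum_step] through 1 - c t = (1 - x t) + (x - c) t, where the factor t
    lowers the index by one. The test guards the truncated subtraction. *)
Lemma residue_sumE A B : uniq B -> residue_sum A B =
  if (size B <= (size A).+1)%N then factor_series A B ((size A).+1 - size B)
  else 0.
Proof.
elim: A B => [|c A IH] B uB.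
  rewrite residue_sum_nil //; case: B uB => [|x [|y B]] //= _.
  by rewrite mulr0 addr0.
case: B uB => [|x B] uB.
  by rewrite /residue_sum big_nil subn0 factor_series_degree.
rewrite residue_sum_step // !IH //; last by case/andP: uB.
rewrite /= !ltnS; case: (ltngtP (size B) (size A).+1) => // [sB|sB|->].
- rewrite (ltnSE sB) !subSS subSn ?(ltnSE sB) // -(factor_series_cancel _ _ x).
  by rewrite /fps_mul_factor; ring.
- by rewrite leqNgt (ltnW sB) mulr0 addr0.
(* Here [x :: B] has one pole too many for [A]; only constant coefficients remain, and they are
   1. *)
rewrite ltnn !subSS !subnn mulr0 addr0 factor_series0.
exact: esym (factor_series0 (c :: A) (x :: B)).
Qed.

End FactorSeries.

(** * Bernoulli polynomials and Pochhammer symbols *)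

(** Coefficients up to n only see truncations to degree n, so associativity comes from
    polynomials. *)
Lemma fps_mulA (F : fieldType) (f g h : nat -> F) :
  fps_mul f (fps_mul g h) =1 fps_mul (fps_mul f g) h.
Proof.
move=> n; pose T u := \poly_(i < n.+1) (u i : F).
have mulT u v i : (i <= n)%N -> (T u * T v)`_i = fps_mul u v i.
  move=> lin; rewrite coefM; apply: eq_bigr => j _; rewrite !coef_poly.
  have lji : (j <= i)%N by rewrite -ltnS ltn_ord.
  by rewrite !ltnS (leq_trans lji lin) (leq_trans (leq_subr _ _) lin).
transitivity (T f * (T g * T h))`_n; last rewrite mulrA.
  rewrite coefM; apply: eq_bigr => i _.
  by rewrite mulT ?leq_subr // coef_poly ltn_ord.
rewrite coefM; apply: eq_bigr => i _.
by rewrite mulT -1?ltnS // coef_poly ltnS leq_subr.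
Qed.

Section Bernoulli.
Variable F : numFieldType.
Implicit Types x : F.

Let factN0 n : (n`!)%:R != 0 :> F. Proof. by rewrite pnatr_eq0 -lt0n fact_gt0. Qed.

(** The coefficient of t^(n+1) in e^((x+1)t) - e^(xt) = t e^(xt) ((e^t - 1) / t). *)
Lemma fps_exp_add1 x n :
  fps_exp (x + 1) n.+1 - fps_exp x n.+1 =
  fps_mul (fps_exp x) (fps_expm1_div F) n.
Proof.
rewrite {1}/fps_exp addrC (addrC x) exprDn big_ord_recr /= subnn binn mul1r.
rewrite mulrDl /fps_exp mulr1n addrC addrK mulr_suml.
apply: eq_bigr => i _; rewrite /fps_expm1_div /fps_exp !expr1n mul1r.
have iSn : (i <= n.+1)%N by rewrite ltnW.
rewrite -subSn -1?ltnS //.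
have binN0 : ('C(n.+1, i))%:R != 0 :> F by rewrite pnatr_eq0 -lt0n bin_gt0.
rewrite -(bin_fact iSn) !natrM -mulr_natr; field.
by rewrite binN0 !factN0.
Qed.

(** The generating function of the difference is e^(xt) (e^t - 1) times t / (e^t - 1), that is t
    e^(xt). *)
Lemma bernoulli_poly_diff x n :
  bernoulli_poly n.+1 (x + 1) - bernoulli_poly n.+1 x = n.+1%:R * x ^+ n.
Proof.
rewrite /bernoulli_poly -mulrBr /fps_mul -sumrB.
under eq_bigr => i _ do rewrite -mulrBl.
rewrite big_ord_recl /= {1 2}/fps_exp !expr0 subrr mul0r add0r.
under eq_bigr => i _ do rewrite /bump /= add1n subSS fps_exp_add1.
rewrite -[\sum_(i < n.+1) _]/(fps_mul (fps_mul _ _) _ n) -fps_mulA.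
rewrite /fps_mul big_ord_recr /= subnn.
have E0 : fps_expm1_div F 0 != 0.
  by rewrite /fps_expm1_div /fps_exp expr1n divr1 oner_neq0.
rewrite big1 ?add0r => [|i _].
  rewrite -[\sum_(i < 1) _]/(fps_mul _ _ 0) fps_mulV // mulr1 /fps_exp factS natrM.
  by field; exact: factN0.
have := fps_mulV E0 (n - i)%N; rewrite /fps_mul => ->.
by rewrite subn_eq0 leqNgt ltn_ord mulr0.
Qed.

Lemma bernoulli_poly_sum x n u :
  bernoulli_poly n.+1 (x + u%:R) - bernoulli_poly n.+1 x =
  n.+1%:R * \sum_(j < u) (x + j%:R) ^+ n.
Proof.
elim: u => [|u IH]; first by rewrite addr0 subrr big_ord0 mulr0.
rewrite big_ord_recr /= mulrDr -IH -bernoulli_poly_diff -natr1 addrA.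
by ring.
Qed.

End Bernoulli.

Section Pochhammer.
Variable F : numFieldType.
Implicit Types (c d : F).

Lemma poch_pred_nat c (n : nat) :
  poch (c - 1) n%:Z * (c - 1 + n%:R) = (c - 1) * poch c n%:Z.
Proof.
rewrite -poch_pS /poch big_ord_recl addr0; congr (_ * _).
by apply: eq_bigr => i _; rewrite lift0 -natr1; ring.
Qed.

Lemma poch_pred c : (forall u : int, c != u%:~R) -> forall z : int,
  poch (c - 1) z * (c - 1 + z%:~R) = (c - 1) * poch c z.
Proof.
move=> cZ [] n; first exact: poch_pred_nat.
have h (u : nat) : c - u%:R != 0 by rewrite subr_eq0; exact: (cZ u).
rewrite /poch big_ord_recr [in RHS]big_ord_recl /= !invfM.
have -> : c - 1 + (Negz n)%:~R = c - 1 - n.+1%:R by rewrite NegzE rmorphN.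
rewrite mulfVK; last by rewrite -addrA -opprD nat1r (h n.+2).
rewrite mulrA divff ?mul1r; last exact: (h 1).
by congr (_^-1); apply: eq_bigr => i _; rewrite /bump /= ?add1n -[i.+2%:R]natr1; ring.
Qed.

(** Absorbs the ratio in the s-th hypergeometric term into a shift of a numerator factor. Only the
    denominator is assumed nonzero, since c = 1 - b_l + a_i may be an integer. *)
Lemma poch_sub_nat c (L s : nat) : poch (1 - c - L%:R) s%:Z != 0 ->
  poch c L%:Z * (poch (1 - c) s%:Z / poch (1 - c - L%:R) s%:Z) =
  poch (c - s%:R) L%:Z.
Proof.
elim: s => [|s IH].
  by move=> _; rewrite /= !big_ord0 divff ?oner_neq0 // mulr1 subr0.
rewrite !poch_pS mulf_eq0 => /norP[h0 h1]; rewrite -[in RHS]natr1 opprD addrA.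
have h2 : c - s%:R - 1 + L%:R != 0.
  by rewrite -oppr_eq0; congr (_ != _) : h1; ring.
apply: (mulIf h2); rewrite poch_pred_nat -IH //.
by field; rewrite h0.
Qed.

(** The analogue for denominator factors: z = n_l + k + 1 may be negative, while c = a_i - a_l is
    never an integer. *)
Lemma poch_sub_int c (z : int) (s : nat) : (forall u : int, c != u%:~R) ->
  (poch c z)^-1 * (poch (1 - c - z%:~R) s%:Z / poch (1 - c) s%:Z) =
  (poch (c - s%:R) z)^-1.
Proof.
move=> cZ.
have pN0 (e : F) (v : int) : (forall u : int, e != u%:~R) -> poch e v != 0.
  move=> eZ; case: v => v; rewrite /poch ?invr_eq0; apply/prodf_neq0 => i _.
    by have := eZ (- (i%:Z)); rewrite -subr_eq0 rmorphN opprK.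
  by rewrite subr_eq0; exact: (eZ i.+1).
have cvZ (v u : int) : c + v%:~R != u%:~R.
  by apply/eqP => h; have /eqP := cZ (u - v); rewrite rmorphB /= -h addrK.
have cv'Z (v u : int) : v%:~R - c != u%:~R.
  apply/eqP => h; have /eqP := cZ (v - u); apply.
  by rewrite rmorphB /= -h; ring.
elim: s => [|s IH].
  by rewrite /= !big_ord0 divff ?oner_neq0 // mulr1 subr0.
rewrite !poch_pS -[in RHS]natr1 opprD addrA.
have csZ u : c - s%:R != u%:~R by have := cvZ (- s%:Z) u; rewrite rmorphN.
have h1 : c - s%:R - 1 != 0.
  by have := csZ 1; rewrite -subr_eq0.
have h2 : c - s%:R - 1 + z%:~R != 0.
  by have := csZ (1 - z); rewrite -subr_eq0 rmorphB /= opprB addrA addrAC.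
have p1 : poch (c - s%:R - 1) z != 0.
  by apply: pN0 => u; have := cvZ (- s%:Z - 1) u; rewrite rmorphB /= rmorphN addrA.
have p2 : poch (c - s%:R) z != 0 by apply: pN0.
have p3 : poch (1 - c) s%:Z != 0 by apply: pN0 => u; exact: (cv'Z 1 u).
have h3 : 1 - c + s%:R != 0 by rewrite -oppr_eq0; congr (_ != _) : h1; ring.
have E := poch_pred csZ z.
have -> : (poch (c - s%:R - 1) z)^-1 =
   (c - s%:R - 1 + z%:~R) / (c - s%:R - 1) * (poch (c - s%:R) z)^-1.
  apply: (mulfI p1); rewrite divff //.
  apply: (mulIf h1); apply: (mulIf p2); rewrite mul1r -E; field.
  by rewrite h1 p2.
rewrite -IH; field.
by rewrite h1 h3 p3 pN0.
Qed.

(** Both sides equal (-1)^s / (s! (K - s)!); the product collects differences of poles within one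
    progression. *)
Lemma poch_oppnat (K s : nat) : (s <= K)%N ->
  poch (- K%:R : F) s%:Z / ((K`!)%:R * (s`!)%:R) =
  (\prod_(j < K.+1 | j != s :> nat) (j%:R - s%:R))^-1.
Proof.
move=> sK.
have fN0 n : (n`!)%:R != 0 :> F by rewrite pnatr_eq0 -lt0n fact_gt0.
have -> : \prod_(j < K.+1 | j != s :> nat) (j%:R - s%:R) =
    (-1) ^+ s * (s`!)%:R * ((K - s)`!)%:R :> F.
  rewrite -(big_mkord (fun j => j != s) (fun j => j%:R - s%:R : F)).
  rewrite (@big_cat_nat _ _ _ s) //=; last exact: leqW.
  rewrite [X in _ * X]big_ltn_cond // eqxx /=; congr (_ * _).
    rewrite big_nat_rev /= add0n fact_prod natr_prod.
    rewrite -[in (-1) ^+ _](subn0 s) -prodr_const_nat big_add1 /= -big_split /=.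
    rewrite big_mkcond; apply: eq_big_nat => j /= js.
    rewrite ltn_eqF /= ?natrB //; first by rewrite mulN1r addrC addKr.
    by rewrite ltn_subrL (leq_ltn_trans _ js).
  rewrite fact_prod natr_prod [RHS]big_add1 /= -{1}[s.+1]add0n big_addn subSS.
  rewrite big_mkcond; apply: eq_big_nat => j _.
  by rewrite addnS gtn_eqF ?ltnS ?leq_addl // -addSn natrD addrK.
have pochK t u : poch (- (t + u)%:R) u%:Z * (t`!)%:R = (-1) ^+ u * ((t + u)`!)%:R :> F.
  elim: u t => [|u IH] t; first by rewrite addn0 /= big_ord0.
  rewrite poch_pS -addSnnS exprS -mulrA -mulrA -IH factS natrM natrD -natr1.
  by ring.
have := pochK (K - s)%N s; rewrite subnK // => E.
have -> : poch (- K%:R) s%:Z = (-1) ^+ s * (K`!)%:R / ((K - s)`!)%:R :> F.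
  by rewrite -E mulfK.
by rewrite !invfM -exprVn invrN1; field; rewrite !fN0.
Qed.
End Pochhammer.

(** * The hypergeometric sum *)

Section Hypergeometric.
Variable R : realType.

Lemma hypergeom1_terminating (K : nat) (u v : seq R[i]) :
  hypergeom1 (- K%:R :: u) v =
  \sum_(s < K.+1) poch (- K%:R : R[i]) s%:Z * (\prod_(x <- u) poch x s%:Z) /
    ((\prod_(y <- v) poch y s%:Z) * (s`!)%:R).
Proof.
rewrite /hypergeom1; apply: (@cvg_lim R[i]^o); first exact: norm_hausdorff.
apply: cvg_near_cst; exists K.+1 => // N /= KN.
rewrite (@big_cat_nat _ _ _ K.+1) //= [X in _ + X]big_nat_cond [X in _ + X]big1 ?addr0.
  by rewrite big_mkord; apply: eq_bigr => s _; rewrite big_cons.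
move=> s; rewrite andbT => /andP[Ks _].
(* For s > K the factor of index K is - K + K = 0, so the term vanishes whatever its denominator. *)
by rewrite big_cons /poch (bigD1 (Ordinal Ks)) //= addNr !mul0r.
Qed.

End Hypergeometric.

(** * Zeros, poles and residues of the rational function f *)

Section PolesAndZeros.
Variables (F : numFieldType) (r : nat) (a b : 'I_r -> F) (m n : 'I_r -> int).
Variable k : int.

Definition int_pos_part (z : int) : nat := if z is Posz u then u else 0.
Definition int_neg_part (z : int) : nat := if z is Negz u then u.+1 else 0.

(* The zeros and poles in y of
   prod_l (1 - b_l - k + y)_(m_l + k) / prod_l (y - a_l - k)_(n_l + k + 1) when
   all m_l + k >= 0; an l with n_l + k + 1 < 0 contributes zeros, not poles. *)
Definition zeros : seq F :=
  [seq b l + k%:~R - 1 - j%:R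
     | l <- enum 'I_r, j <- index_iota 0 (int_pos_part (m l + k))] ++
  [seq a l + k%:~R + j.+1%:R
     | l <- enum 'I_r, j <- index_iota 0 (int_neg_part (n l + k + 1))].

Definition poles : seq F :=
  [seq a l + k%:~R - j%:R
     | l <- enum 'I_r, j <- index_iota 0 (int_pos_part (n l + k + 1))].

(** One of the two products is always empty, which treats both signs of z at once. *)
Lemma poch_pos_neg (c : F) (z : int) :
  (poch c z)^-1 =
  (\prod_(j < int_neg_part z) (c - j.+1%:R)) / \prod_(j < int_pos_part z) (c + j%:R).
Proof.
by case: z => u /=; rewrite big_ord0 ?invrK ?invr1 ?mulr1 ?mul1r.
Qed.

Lemma size_zeros_poles : (forall l, 0 <= m l + k) ->
  (size zeros)%:Z - (size poles)%:Z =
  \sum_(l < r) m l - \sum_(l < r) n l - r%:Z.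
Proof.
move=> mk; rewrite size_cat !size_allpairs_dep !sumnE 3!big_map !big_enum /=.
have rE : r%:Z = \sum_(l < r) 1 by rewrite sumr_const card_ord natz.
rewrite rE PoszD !(big_morph Posz PoszD (erefl 0%:Z)) -big_split -!sumrB /=.
apply: eq_bigr => l _; rewrite !size_iota !subn0.
have := mk l; case mE: (m l + k) => [u|u] // _.
case nE: (n l + k + 1) => [w|w] /=; lia.
Qed.

(** Distinct progressions lie in distinct classes modulo the integers, and none repeats a value in
    characteristic 0. *)
Lemma uniq_poles :
  (forall i j : 'I_r, i != j -> forall z : int, a i - a j != z%:~R) ->
  uniq poles.
Proof.
move=> a_diff; apply: allpairs_uniq_dep => [|l _|].
- exact: enum_uniq.
- exact: iota_uniq.
move=> [l j] [l' j'] _ _ /= E; have ll : l = l'.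
  apply/eqP; apply: contraT => /a_diff/(_ (j%:Z - j'%:Z))/eqP[].
  rewrite rmorphB /=; apply/eqP; rewrite subr_eq; apply/eqP.
  have {}E := congr1 (fun x => x - k%:~R + j%:R) E.
  rewrite (_ : a l = a l + k%:~R - j%:R - k%:~R + j%:R); last by ring.
  by rewrite E; ring.
case: _ / ll E => /addrI/oppr_inj/eqP; rewrite eqr_nat => /eqP -> //.
Qed.

Lemma sum_pow_zeros_poles q : (forall l, 0 <= m l + k) ->
  \sum_(x <- poles) x ^+ q - \sum_(x <- zeros) x ^+ q =
  (-1) ^+ q.+1 / q.+1%:R *
  \sum_(i < r)
    (bernoulli_poly q.+1 (- a i - k%:~R)
     - bernoulli_poly q.+1 (- b i + 1 - k%:~R)
     + bernoulli_poly q.+1 (1 - b i + (m i)%:~R)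
     - bernoulli_poly q.+1 (1 - a i + (n i)%:~R)).
Proof.
move=> mk; rewrite big_cat /= !big_allpairs_dep !big_enum /= opprD addrA.
rewrite -!sumrB mulr_sumr; apply: eq_bigr => l _; rewrite !big_mkord.
have q0 : q.+1%:R != 0 :> F by rewrite pnatr_eq0.
have -> : bernoulli_poly q.+1 (1 - b l + (m l)%:~R) =
    bernoulli_poly q.+1 (- b l + 1 - k%:~R) +
    q.+1%:R * \sum_(j < int_pos_part (m l + k)) (- b l + 1 - k%:~R + j%:R) ^+ q.
  rewrite -bernoulli_poly_sum [RHS]addrC subrK; congr bernoulli_poly.
  have := mk l; case E: (m l + k) => [u|] // _ /=.
  rewrite (_ : u%:R = (m l + k)%:~R); last by rewrite E.
  by rewrite rmorphD /=; ring.
(* For n_l + k + 1 < 0 the progression runs backwards and enters with a minus sign, so one Bernoulli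
   difference covers poles and zeros. *)
have -> : bernoulli_poly q.+1 (1 - a l + (n l)%:~R) =
    bernoulli_poly q.+1 (- a l - k%:~R)
    + q.+1%:R * \sum_(j < int_pos_part (n l + k + 1)) (- a l - k%:~R + j%:R) ^+ q
    - q.+1%:R * \sum_(j < int_neg_part (n l + k + 1)) (- a l - k%:~R - j.+1%:R) ^+ q.
  case E: (n l + k + 1) => [u|u] /=; rewrite big_ord0 mulr0 ?subr0 ?addr0.
    rewrite -bernoulli_poly_sum [RHS]addrC subrK; congr bernoulli_poly.
    rewrite (_ : u%:R = (n l + k + 1)%:~R); last by rewrite E.
    by rewrite !rmorphD /=; ring.
  rewrite (_ : \sum_(j < u.+1) _ = \sum_(j < u.+1) (1 - a l + (n l)%:~R + j%:R) ^+ q).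
    rewrite -bernoulli_poly_sum opprB [RHS]addrC.
    rewrite (_ : 1 - a l + (n l)%:~R + u.+1%:R = - a l - k%:~R) ?subrK //.
    rewrite (_ : u.+1%:R = - (n l + k + 1)%:~R); last by rewrite E NegzE rmorphN opprK.
    by rewrite !rmorphD /=; ring.
  rewrite (reindex_inj rev_ord_inj) /=; apply: eq_bigr => j _; congr (_ ^+ q).
  rewrite -subSn ?ltn_ord // subSS -[(u.+1 - j)%N%:R]/((u.+1 - j)%N%:Z%:~R).
  rewrite (_ : (u.+1 - j)%N%:Z = - (n l + k + 1) - j%:Z); last first.
    by rewrite E NegzE opprK -subzn // ltnW.
  by rewrite rmorphB rmorphN !rmorphD /=; ring.
(* Negation turns the three progressions into those above, at the price of (-1)^q. *)
have e1 : \sum_(j < int_pos_part (n l + k + 1)) (a l + k%:~R - j%:R) ^+ q =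
   (-1) ^+ q * \sum_(j < int_pos_part (n l + k + 1)) (- a l - k%:~R + j%:R) ^+ q.
  by rewrite mulr_sumr; apply: eq_bigr => j _; rewrite -exprMn; congr (_ ^+ q); ring.
have e2 : \sum_(j < int_neg_part (n l + k + 1)) (a l + k%:~R + j.+1%:R) ^+ q =
   (-1) ^+ q * \sum_(j < int_neg_part (n l + k + 1)) (- a l - k%:~R - j.+1%:R) ^+ q.
  by rewrite mulr_sumr; apply: eq_bigr => j _; rewrite -exprMn; congr (_ ^+ q); ring.
have e3 : \sum_(j < int_pos_part (m l + k)) (b l + k%:~R - 1 - j%:R) ^+ q =
   (-1) ^+ q * \sum_(j < int_pos_part (m l + k)) (- b l + 1 - k%:~R + j%:R) ^+ q.
  by rewrite mulr_sumr; apply: eq_bigr => j _; rewrite -exprMn; congr (_ ^+ q); ring.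
rewrite e1 e2 e3 exprS; field.
by rewrite nat1r.
Qed.

End PolesAndZeros.

Lemma residue_sum_zeros_poles (F : numFieldType) (r : nat) (a b : 'I_r -> F)
    (m n : 'I_r -> int) (k : int) :
  (forall l, 0 <= m l + k) ->
  (forall i j : 'I_r, i != j -> forall z : int, a i - a j != z%:~R) ->
  residue_sum (zeros a b m n k) (poles a n k) =
  \sum_(i < r) \sum_(s < int_pos_part (n i + k + 1))
    (\prod_(l < r) poch (1 - b l + a i - s%:R) (m l + k)) *
    (\prod_(l < r | l != i) (poch (a i - a l - s%:R) (n l + k + 1))^-1) *
    (\prod_(j < int_pos_part (n i + k + 1) | j != s :> nat) (j%:R - s%:R))^-1.
Proof.
move=> mk a_diff; rewrite /residue_sum {1}/poles big_allpairs_dep big_enum /=.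
apply: eq_bigr => i _; rewrite big_mkord; apply: eq_bigr => s _.
set x := a i + _ - _.
have num_b : \prod_(l < r) \prod_(j < int_pos_part (m l + k))
      (x - (b l + k%:~R - 1 - j%:R)) =
    \prod_(l < r) poch (1 - b l + a i - s%:R) (m l + k).
  apply: eq_bigr => l _; have := mk l; case: (m l + k) => // u _ /=.
  by apply: eq_bigr => j _; rewrite /x; ring.
have num_a : \prod_(l < r) \prod_(j < int_neg_part (n l + k + 1))
      (x - (a l + k%:~R + j.+1%:R)) =
    \prod_(l < r | l != i)
      \prod_(j < int_neg_part (n l + k + 1)) (a i - a l - s%:R - j.+1%:R).
  rewrite (bigD1 i) //= [X in X * _](_ : _ = 1) ?mul1r.
    by apply: eq_bigr => l _; apply: eq_bigr => j _; rewrite /x; ring.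
  (* A pole in the i-th progression forces n_i + k + 1 > 0, so l = i contributes no zeros. *)
  have := leq_ltn_trans (leq0n s) (ltn_ord s).
  by case: (n i + k + 1) => //= u; rewrite big_ord0.
have den : \prod_(y <- poles a n k | y != x) (x - y) =
    (\prod_(l < r | l != i)
      \prod_(j < int_pos_part (n l + k + 1)) (a i - a l - s%:R + j%:R)) *
    \prod_(j < int_pos_part (n i + k + 1) | j != s :> nat) (j%:R - s%:R).
  rewrite big_mkcond big_allpairs_dep big_enum /= (bigD1 i) //= mulrC; congr (_ * _).
    apply: eq_bigr => l li; rewrite big_mkord; apply: eq_bigr => j _.
    (* A coincidence would make a_l - a_i an integer. *)
    have -> : a l + k%:~R - j%:R != x.
      apply/eqP => E; have /eqP := a_diff _ _ li (j%:Z - s%:Z); apply.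
      rewrite rmorphB /=; transitivity (a l + k%:~R - j%:R - k%:~R - a i + j%:R); first ring.
      by rewrite E /x; ring.
    by rewrite /x; ring.
  rewrite big_mkord [RHS]big_mkcond; apply: eq_bigr => j _.
  rewrite /x (inj_eq (addrI _)) eqr_opp eqr_nat; case: eqP => // _.
  by ring.
rewrite big_cat /= !big_allpairs_dep !big_enum /=.
under eq_bigr => l _ do rewrite big_mkord.
rewrite num_b; under [X in _ * X / _]eq_bigr => l _ do rewrite big_mkord.
rewrite num_a den invfM !mulrA; congr (_ / _); rewrite -!mulrA; congr (_ * _).
by rewrite -prodfV -big_split; apply: eq_bigr => l _ /=; rewrite poch_pos_neg.
Qed.

(** * Both sides as a series coefficient and a sum of residues *)

Section Main.
Variables (R : realType) (r : nat) (a b : 'I_r -> R[i]) (m n : 'I_r -> int).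
Variable k : int.

(** Both sequences start with 1 and satisfy p g_p = sum_(j = 1 .. p) s_j g_(p-j). *)
Lemma qval_factor_series (p : nat) : (forall l, 0 <= m l + k) ->
  qval a b m n p%:Z k = factor_series (zeros a b m n k) (poles a n k) p.
Proof.
move=> mk; move: p; pose s q := \sum_(x <- poles a n k) x ^+ q
  - \sum_(x <- zeros a b m n k) x ^+ q.
apply: (@logder_unique _ s).
- by rewrite factor_series0 qval0.
- case=> [|p]; first by rewrite /logder_defect big_ord0 mul0r subr0.
  rewrite /logder_defect qvalS // mulrA divff ?pnatr_eq0 // mul1r.
  apply/eqP; rewrite subr_eq0; apply/eqP.
  rewrite big_add1 /= big_nat_rev /= big_mkord; apply: eq_bigr => i _.
  have ip : (i <= p)%N by rewrite -ltnS.
  have e : (p.+1 - (p - i).+1)%N = i by rewrite subSS subKn.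
  rewrite add0n [(p.+1 - i.+1)%N]subSS e.
  by rewrite /s sum_pow_zeros_poles // subSn.
- exact: logder_factor_series.
Qed.

(** Holds term by term: each ratio of Pochhammer symbols moves the argument of a prefactor symbol by
    s, giving the residue at y = a_i + k - s. *)
Lemma prefactor_hypergeom1 (K : nat) (i : 'I_r) :
  k + n i = K%:Z ->
  (forall l, 0 <= m l + k) ->
  (forall i j : 'I_r, i != j -> forall z : int, a i - a j != z%:~R) ->
  (forall (l : 'I_r) (s : nat), (s <= K)%N ->
     poch (b l - a i - (m l)%:~R - k%:~R) s%:Z != 0) ->
  prefactor a b m n k i *
    hypergeom1 (upper_params a b n k i) (lower_params a b m k i) =
  \sum_(s < K.+1)
    (\prod_(l < r) poch (1 - b l + a i - s%:R) (m l + k)) *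
    (\prod_(l < r | l != i) (poch (a i - a l - s%:R) (n l + k + 1))^-1) *
    (\prod_(j < K.+1 | j != s :> nat) (j%:R - s%:R))^-1.
Proof.
move=> nK mk a_diff bN0; rewrite /upper_params nK hypergeom1_terminating mulr_sumr.
apply: eq_bigr => s _; rewrite /lower_params /prefactor nK absz_nat.
have prod_all (f : 'I_r -> R[i]) : \prod_(x <- [seq f l | l <- enum 'I_r]) poch x s%:Z =
    \prod_(l < r) poch (f l) s%:Z by rewrite big_map big_enum.
have prod_other (f : 'I_r -> R[i]) :
    \prod_(x <- [seq f l | l <- enum 'I_r & l != i]) poch x s%:Z =
    \prod_(l < r | l != i) poch (f l) s%:Z by rewrite big_map big_filter big_enum_cond.
have prod_cat (u v : seq R[i]) : \prod_(x <- u ++ v) poch x s%:Z =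
    (\prod_(x <- u) poch x s%:Z) * \prod_(x <- v) poch x s%:Z by exact: big_cat.
rewrite !prod_cat !prod_all !prod_other.
rewrite -poch_oppnat -1?ltnS // !invfM -!prodfV.
have zero_factor l : poch (1 - b l + a i - s%:R) (m l + k) =
    poch (1 - b l + a i) (m l + k) *
    (poch (b l - a i) s%:Z * (poch (b l - a i - (m l)%:~R - k%:~R) s%:Z)^-1).
  have := mk l; case E: (m l + k) => [L|//] _.
  have LE : b l - a i - (m l)%:~R - k%:~R = 1 - (1 - b l + a i) - L%:R.
    by rewrite -[L%:R]/(L%:Z%:~R) -E rmorphD /=; ring.
  have sK : (s <= K)%N by rewrite -ltnS.
  have := bN0 l s sK; rewrite LE => h; rewrite -(poch_sub_nat h).
  by congr (_ * (poch _ _ / _)); ring.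
have pole_factor l : l != i -> (poch (a i - a l - s%:R) (n l + k + 1))^-1 =
    (poch (a i - a l) (n l + k + 1))^-1 *
    (poch (1 + a l - a i - (n l)%:~R - k%:~R - 1) s%:Z *
     (poch (1 + a l - a i) s%:Z)^-1).
  move=> li; rewrite -poch_sub_int => [|u]; last by apply: a_diff; rewrite eq_sym.
  by congr (_ * (poch _ _ / poch _ _)); rewrite ?rmorphD /=; ring.
rewrite (eq_bigr _ (fun l _ => zero_factor l)) (eq_bigr _ pole_factor).
have prodM (P : pred 'I_r) (f g : 'I_r -> R[i]) :
    \prod_(l | P l) (f l * g l) = (\prod_(l | P l) f l) * \prod_(l | P l) g l.
  exact: big_split.
rewrite !prodM.
by ring.
Qed.

End Main.

Theorem theorem6p2 (R : realType) (r : nat) (r_gt0 : (0 < r)%N)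
    (a b : 'I_r -> R[i]) (m n : 'I_r -> int)
    (* a_i - a_j is not an integer for i <> j *)
    (a_diff : forall i j : 'I_r, i != j ->
       forall z : int, a i - a j != z%:~R) :
  let M : int := \sum_(i < r) m i in
  let N : int := \sum_(i < r) n i in
  let p : int := Num.max (- 1) (M - N - r%:Z + 1) in
  (forall k : int, - vmin r_gt0 m <= k ->
     (* well-definedness: no denominator of a term of the terminating series
        vanishes (this holds when b_l - a_i is never an integer) *)
     (forall (i l : 'I_r) (s : nat), s%:Z <= k + n i ->
        poch (b l - a i - (m l)%:~R - k%:~R) s%:Z != 0) ->
     \sum_(i < r | 0 <= k + n i)
       prefactor a b m n k i *
       hypergeom1 (upper_params a b n k i) (lower_params a b m k i)
     = qval a b m n p k)
  /\ (forall k : int, qval a b m n 1 k = Qsum a b m n 1 k / 2%:R)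
  /\ (forall k : int, qval a b m n 2 k =
        Qsum a b m n 1 k ^+ 2 / 8%:R - Qsum a b m n 2 k / 6%:R).
Proof.
move=> M N p.
have q1 k : qval a b m n 1 k = Qsum a b m n 1 k / 2%:R.
  by rewrite (@qvalS _ _ _ _ _ _ 1) // big_nat1 qval0 mulr1 sqrrN expr1n; field.
split; [move=> k mk bN0 | split => // k]; last first.
  rewrite (@qvalS _ _ _ _ _ _ 2) // big_nat_recr // big_nat1 subnn qval0.
  rewrite (_ : (2 - 1)%N = 1%N) // q1.
  by rewrite /=; field.
(* The bound on k makes every numerator factor of f a polynomial in y. *)
have {}mk l : 0 <= m l + k.
  have : vmin r_gt0 m <= m l by apply: bigmin_le.
  by lia.
transitivity (residue_sum (zeros a b m n k) (poles a n k)).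
  rewrite residue_sum_zeros_poles // big_mkcond; apply: eq_bigr => i _.
  case: ifP => [|/negbT]; last first.
    (* An i with k + n_i < 0 has no poles, which matches the terms taken to be zero. *)
    move=> kn; have -> : int_pos_part (n i + k + 1) = 0%N.
      by case E: (n i + k + 1) => [u|u] //=; lia.
    by rewrite big_ord0.
  case E: (k + n i) => [K|//] _.
  have -> : int_pos_part (n i + k + 1) = K.+1.
    by case E': (n i + k + 1) => [u|u] /=; lia.
  by apply: prefactor_hypergeom1 => // l s sK; apply: bN0; rewrite E lez_nat.
have sizeE := size_zeros_poles a b n mk; rewrite -/M -/N in sizeE.
(* The coefficient index is p when nonnegative; otherwise there are too many poles, p = -1 and both
   sides are 0. *)
rewrite residue_sumE ?uniq_poles // /p -sizeE; case: ifPn => sz.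
  by rewrite -qval_factor_series //; congr (qval _ _ _ _ _ _); lia.
by rewrite [Num.max _ _](_ : _ = -1) //; lia.
Qed.
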